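(* Let $0<\beta<\alpha<1$ satisfy $$\frac{1-\beta}{\alpha}\sqrt{\frac{2}{\pi}}\,\frac{e^{-\left(\operatorname{erfinv}\left(\frac{1-\alpha}{1-\beta}\right)\right)^2}}{\sqrt{2}\,\operatorname{erfinv}\left(\frac{1-\alpha}{1-\beta}\right)}=1 .$$ Then the net exponent of the geometric (polytope angle) analysis of $\ell_1$-optimization vanishes at $(\alpha,\beta)$: $$\Psi_{net}(\beta,\alpha)=\Psi_{com}(\beta,\alpha)-\Psi_{int}(\beta,\alpha)-\Psi_{ext}(\beta,\alpha)=0 .$$
   Context: $\log$ is the natural logarithm, $\operatorname{erf}(r)=\frac{2}{\sqrt{\pi}}\int_0^r e^{-q^2}\,dq$, and $\operatorname{erfinv}$ is its inverse. For $0<\beta<\alpha<1$ the exponents are defined as follows. Combinatorial exponent: $\Psi_{com}(\beta,\alpha)=(\alpha-\beta)\log 2+(1-\beta)H\left(\frac{\alpha-\beta}{1-\beta}\right)$, where $H(p)=-p\log p-(1-p)\log(1-p)$. Internal angle exponent: put $\gamma=\beta/\alpha$, $\Phi(s)=\frac{1}{\sqrt{2\pi}}\int_s^\infty e^{-x^2/2}\,dx$, $\phi(s)=\frac{1}{\sqrt{2\pi}}e^{-s^2/2}$. Let $s_\gamma>0$ be the solution of $\Phi(s)=(1-\gamma)\frac{\phi(s)}{s}$, let $y_\gamma=\frac{\gamma}{1-\gamma}s_\gamma$, and let $\xi_\gamma(y_\gamma)=-\frac12 y_\gamma^2\frac{1-\gamma}{\gamma}-\frac12\log\frac{2}{\pi}+\log\frac{y_\gamma}{\gamma}$.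 Then $\Psi_{int}(\beta,\alpha)=(\alpha-\beta)\xi_\gamma(y_\gamma)+(\alpha-\beta)\log 2$. External angle exponent: $\Psi_{ext}(\beta,\alpha)=\min_{y\ge 0}\left(\alpha y^2-(1-\alpha)\log(\operatorname{erf}(y))\right)$, where the function being minimized is taken to be $+\infty$ at $y=0$. *)

(* Defs.v *)
(* Real analysis over an arbitrary R : realType (MathComp-Analysis).          *)
From mathcomp Require Import all_boot all_order all_algebra.
From mathcomp Require Import all_classical all_reals all_analysis.
Set Implicit Arguments.
Unset Strict Implicit.
Unset Printing Implicit Defensive.
Import Order.TTheory GRing.Theory Num.Theory.
Import numFieldNormedType.Exports.
Local Open Scope classical_set_scope.
Local Open Scope ring_scope.

(* "The x satisfying P" is rendered xget 0 P: it satisfies P as soon as some  *)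
(* element does, and is 0 otherwise.                                          *)

Section exponents.
Context {R : realType}.
Implicit Types r p s y g alpha beta : R.
Local Notation mu := (@lebesgue_measure R).

(* The integral is oriented: int_0^r = - int_r^0 for r < 0. *)
Definition erf r : R :=
  2 / Num.sqrt pi *
  (if 0 <= r then \int[mu]_(q in `[0, r]) expR (- q ^+ 2)
   else - \int[mu]_(q in `[r, 0]) expR (- q ^+ 2)).

Definition erfinv p : R := xget 0 [set r | erf r = p].

Definition entropy p : R := - p * ln p - (1 - p) * ln (1 - p).

Definition Psi_com beta alpha : R :=
  (alpha - beta) * ln 2 + (1 - beta) * entropy ((alpha - beta) / (1 - beta)).

Definition gauss_tail s : R :=
  1 / Num.sqrt (2 * pi) * \int[mu]_(x in `[s, +oo[) expR (- x ^+ 2 / 2).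

Definition gauss_density s : R :=
  1 / Num.sqrt (2 * pi) * expR (- s ^+ 2 / 2).

Definition s_int g : R :=
  xget 0 [set s | 0 < s /\ gauss_tail s = (1 - g) * (gauss_density s / s)].

Definition y_int g : R := g / (1 - g) * s_int g.

Definition xi_int g y : R :=
  - (1 / 2) * y ^+ 2 * ((1 - g) / g) - 1 / 2 * ln (2 / pi) + ln (y / g).

Definition Psi_int beta alpha : R :=
  let g := beta / alpha in
  (alpha - beta) * xi_int g (y_int g) + (alpha - beta) * ln 2.

(* The case split is needed because ln 0 = 0. *)
Definition ext_fun alpha y : \bar R :=
  if y == 0 then +oo%E
  else (alpha * y ^+ 2 - (1 - alpha) * ln (erf y))%:E.

Definition ext_values alpha : set (\bar R) :=
  [set ext_fun alpha y | y in [set y | 0 <= y]].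

(* An attained minimum, not merely an infimum. *)
Definition Psi_ext beta alpha : R :=
  xget 0 [set m : R | (ext_values alpha `&` lbound (ext_values alpha)) m%:E].

Definition Psi_net beta alpha : R :=
  Psi_com beta alpha - Psi_int beta alpha - Psi_ext beta alpha.

End exponents.

(* Main.v *)
(** Write e = erfinv ((1 - alpha) / (1 - beta)), so that the threshold condition
    reads exp (- e^2) = alpha sqrt(pi) e / (1 - beta).  This is at once
    - the defining equation of s_gamma at s = sqrt 2 e, because
      Phi (sqrt 2 e) = (1 - erf e) / 2, and
    - the critical point equation at y = e of the function minimized in Psi_ext.
    With these values of s_gamma and y, and q = (alpha - beta) / (1 - beta),
      Psi_int = - alpha e^2 - (alpha - beta) log q + (alpha - beta) log 2,
      Psi_ext = alpha e^2 - (1 - alpha) log (1 - q),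
    whose sum is Psi_com.  What needs analysis is that s_gamma is unique and
    that the critical point is the minimizer. *)

Require Import Defs.
From mathcomp Require Import all_boot all_order all_algebra.
From mathcomp Require Import all_classical all_reals all_analysis.
From mathcomp Require Import ring lra.
Set Implicit Arguments.
Unset Strict Implicit.
Unset Printing Implicit Defensive.
Import Order.TTheory GRing.Theory Num.Theory.
Import numFieldNormedType.Exports.
Local Open Scope classical_set_scope.
Local Open Scope ring_scope.

(** * The error function and the Gaussian tail *)

Section erf.
Context {R : realType}.
Implicit Types (x y r s : R).
Local Notation gauss_int := (@gauss_integral_proof.integral0_gauss R).

Lemma sqrt_pi_gt0 : 0 < Num.sqrt pi :> R.
Proof. by rewrite sqrtr_gt0 pi_gt0. Qed.

Lemma erf_gauss_int r : 0 <= r -> erf r = 2 / Num.sqrt pi * gauss_int r.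
Proof. by move=> r0; rewrite /erf r0. Qed.

Lemma erf_ge0 r : 0 <= r -> 0 <= erf r.
Proof.
move=> r0; rewrite erf_gauss_int// mulr_ge0 ?divr_ge0 ?sqrtr_ge0//.
exact: gauss_integral_proof.integral0_gauss_ge0.
Qed.

(** Serves to show that a preimage of a positive number under [erf] is positive. *)
Lemma erf_le0 r : r <= 0 -> erf r <= 0.
Proof.
move=> r0; rewrite /erf; case: ifPn => [r0'|_].
  have -> : r = 0 by apply/eqP; rewrite eq_le r0 r0'.
  by rewrite set_itv1 Rintegral_set1 mulr0.
rewrite mulr_ge0_le0 ?divr_ge0 ?sqrtr_ge0// oppr_le0.
by apply: Rintegral_ge0 => x _; exact: expR_ge0.
Qed.

Lemma is_derive_erf x : 0 < x ->
  is_derive x 1 (@erf R) (2 / Num.sqrt pi * expR (- x ^+ 2)).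
Proof.
move=> x0.
have [dI eI] : derivable gauss_int x 1 /\ gauss_int^`()%classic x = gauss_fun x.
  apply: (@continuous_FTC1_closed R gauss_fun 0 x (x + 1)) => //.
  - by rewrite ltrDl.
  - apply: continuous_compact_integrable => //; first exact: segment_compact.
    by apply: continuous_subspaceT; exact: continuous_gauss_fun.
  - exact: continuous_gauss_fun.
have ? : is_derive x 1 gauss_int (expR (- x ^+ 2)).
  by apply: DeriveDef => //; rewrite -derive1E.
(* The identity with [gauss_int] is known for nonnegative arguments, which covers a neighbourhood of
   x > 0. *)
apply: (@near_eq_is_derive _ _ _ (fun y => 2 / Num.sqrt pi *: gauss_int y)).
  near=> y; rewrite erf_gauss_int//.
  by apply/ltW; near: y; exact: lt_nbhsr.
Unshelve. all: end_near.
Qed.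

(** The known limit, pi / 4, is that of the square of [gauss_int]; since [gauss_int] is nonnegative,
    taking square roots gives sqrt(pi) / 2. *)
Lemma cvg_erf : @erf R x @[x --> +oo] --> (1 : R).
Proof.
have cvgI : gauss_int x @[x --> +oo] --> Num.sqrt pi / 2.
  have -> : Num.sqrt pi / 2 = Num.sqrt (pi / 4) :> R.
    rewrite sqrtrM ?pi_ge0// sqrtrV// (_ : 4 = 2 ^+ 2) -?natrX//.
    by rewrite natrX sqrtr_sqr ger0_norm.
  rewrite (_ : (fun _ => _) = fun x => Num.sqrt (gauss_int x ^+ 2)).
    apply: continuous_cvg; first exact: sqrt_continuous.
    exact: gauss_integral_proof.cvg_integral0_gauss_sqr.
  apply/funext => x; rewrite sqrtr_sqr ger0_norm//.
  exact: gauss_integral_proof.integral0_gauss_ge0.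
have : 2 / Num.sqrt pi * gauss_int x @[x --> +oo] --> (1 : R).
  rewrite [X in _ --> X](_ : _ = 2 / Num.sqrt pi * (Num.sqrt pi / 2)).
    by apply: cvgM => //; exact: cvg_cst.
  by field; rewrite gt_eqF ?sqrt_pi_gt0.
apply: cvg_trans; apply: near_eq_cvg.
by near=> x; rewrite erf_gauss_int.
Unshelve. all: end_near.
Qed.

(** With an explicit derivative, the sign of [df] decides monotonicity; applied to [erf], to
    [mills_defect] and to the function minimized in [Psi_ext]. *)
Lemma MVT_is_derive (f df : R -> R) a b : a < b ->
    (forall x, a <= x <= b -> is_derive x 1 f (df x)) ->
  exists2 c, a < c < b & f b - f a = df c * (b - a).
Proof.
move=> ab fdf.
have [c cab fE] : exists2 c, c \in `]a, b[ & f b - f a = df c * (b - a).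
  apply: MVT => // [x|].
    by rewrite in_itv/= => /andP[ax xb]; apply: fdf; rewrite !ltW.
  apply: derivable_within_continuous => x; rewrite in_itv/= => xab.
  exact: (@ex_derive _ _ _ _ _ _ _ (fdf _ xab)).
by exists c => //; move: cab; rewrite in_itv.
Qed.

Lemma erf_lt x y : 0 < x -> x < y -> erf x < erf y.
Proof.
move=> x0 xy.
have dE z : x <= z <= y ->
    is_derive z 1 (@erf R) (2 / Num.sqrt pi * expR (- z ^+ 2)).
  by move=> /andP[xz _]; apply: is_derive_erf; exact: lt_le_trans xz.
have [c _ eE] := MVT_is_derive xy dE.
rewrite -subr_gt0 eE mulr_gt0 ?subr_gt0// mulr_gt0 ?expR_gt0//.
by rewrite divr_gt0 ?sqrt_pi_gt0.
Qed.

Lemma erf_gt0 x : 0 < x -> 0 < erf x.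
Proof.
move=> x0; apply: (@le_lt_trans _ _ (erf (x / 2))).
  by rewrite erf_ge0// divr_ge0// ltW.
by apply: erf_lt; lra.
Qed.

(** Combined with [gauss_tailE], this bounds [erf] by 1 on the positive reals. *)
Lemma gauss_tail_ge0 s : 0 <= gauss_tail s.
Proof.
rewrite /gauss_tail mulr_ge0 ?divr_ge0 ?sqrtr_ge0//.
by apply: Rintegral_ge0 => x _; exact: expR_ge0.
Qed.

(** The substitution x = sqrt 2 q, carried out through a primitive [F] of the integrand whose limit
    at infinity comes from [cvg_erf]. *)
Lemma gauss_tailE s : 0 < s -> gauss_tail s = (1 - erf (s / Num.sqrt 2)) / 2.
Proof.
move=> s0.
have sqrt2_gt0 : 0 < Num.sqrt 2 :> R by rewrite sqrtr_gt0.
have sqrt2_neq0 : Num.sqrt 2 != 0 :> R by rewrite gt_eqF.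
have sqrtpi_neq0 : Num.sqrt pi != 0 :> R by rewrite gt_eqF ?sqrt_pi_gt0.
have sqrt2K : Num.sqrt 2 ^+ 2 = 2 :> R by rewrite sqr_sqrtr.
pose F x := Num.sqrt (2 * pi) / 2 * erf (x / Num.sqrt 2) : R.
have dF x : 0 < x -> is_derive x 1 F (expR (- x ^+ 2 / 2)).
  move=> x0; have x20 : 0 < x / Num.sqrt 2 by rewrite divr_gt0.
  have dg : is_derive x 1 (fun y => y / Num.sqrt 2) (Num.sqrt 2)^-1.
    rewrite (_ : (fun _ => _) = (fun y => (Num.sqrt 2)^-1 *: y)); last first.
      by apply/funext => y; rewrite mulrC.
    by apply: is_derive_eq; rewrite /GRing.scale/= mulr1.
  have ? := @is_derive1_comp _ (@erf R) (fun y => y / Num.sqrt 2) x _ _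
    (is_derive_erf x20) dg.
  rewrite (_ : F = (Num.sqrt (2 * pi) / 2) \*:
    (@erf R \o (fun y => y / Num.sqrt 2)))//.
  apply: is_derive_eq.
  rewrite /GRing.scale/= expr_div_n sqrt2K -mulNr sqrtrM//.
  by field; rewrite sqrt2_neq0 sqrtpi_neq0.
rewrite /gauss_tail (@Rintegral_ge0_continuous_FTC2y _ _ F _ (Num.sqrt (2 * pi) / 2)).
- rewrite /F sqrtrM//; field; rewrite sqrt2_neq0 sqrtpi_neq0//.
- by move=> x _; exact: expR_ge0.
- apply: derivable_within_continuous => x _.
  exact: ex_derive.
- rewrite -[X in _ --> X]mulr1; apply: cvgM; first exact: cvg_cst.
  apply: (cvg_comp (fun x => x / Num.sqrt 2) (@erf R)); last exact: cvg_erf.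
  by apply: gt0_cvgMly; [rewrite invr_gt0|exact: cvg_id].
- by move=> x sx; exact: (@ex_derive _ _ _ _ _ _ _ (dF _ (lt_trans s0 sx))).
- apply: cvg_at_right_filter; apply: differentiable_continuous.
  by apply/derivable1_diffP; exact: (@ex_derive _ _ _ _ _ _ _ (dF _ s0)).
- move=> x; rewrite in_itv/= andbT => sx; rewrite derive1E.
  exact: (@derive_val _ _ _ _ _ _ _ (dF _ (lt_trans s0 sx))).
Qed.

End erf.

(** * Internal angle: uniqueness of s_gamma *)

Section exponents.
Context {R : realType}.
Implicit Types (r s g e alpha beta : R).

Lemma is_derive_gauss_div r : 0 < r ->
  is_derive r 1 (fun x => expR (- x ^+ 2) / x)
    (- (expR (- r ^+ 2) * (2 + r ^- 2))).
Proof.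
move=> r0.
have de : is_derive r 1 (fun x => expR (- x ^+ 2)) (expR (- r ^+ 2) * - (2 * r)).
  have dN : is_derive r 1 (fun x : R => - x ^+ 2) (- (2 * r)).
    apply: is_derive_eq; rewrite /GRing.scale/=.
    by ring.
  exact: (@is_derive1_comp _ expR (fun x => - x ^+ 2) r _ _ _ dN).
have dV : is_derive r 1 (fun x : R => x^-1) (- r ^- 2).
  have := @is_deriveV R id r 1 1; rewrite gt_eqF// => /(_ isT) h.
  by apply: is_derive_eq; rewrite /GRing.scale/= mulr1.
have dM := @is_deriveM _ _ (fun x : R => expR (- x ^+ 2)) (fun x : R => x^-1)
  r 1 _ _ de dV.
apply: (is_derive_eq dM); rewrite /GRing.scale/=.
by field; rewrite gt_eqF.
Qed.

(** Twice the difference of the two sides of the equation defining s_gamma, taken at s = sqrt 2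
    r. *)
Definition mills_defect g r : R :=
  1 - erf r - (1 - g) / Num.sqrt pi * (expR (- r ^+ 2) / r).

(** Both nonconstant terms differentiate to multiples of the same exponential, so the sign is that
    of a rational function of r. *)
Lemma is_derive_mills_defect g r : 0 < r ->
  is_derive r 1 (mills_defect g)
    (expR (- r ^+ 2) / Num.sqrt pi * ((1 - g) / r ^+ 2 - 2 * g)).
Proof.
move=> r0.
have ? := is_derive_erf r0; have ? := is_derive_gauss_div r0.
have -> : mills_defect g = (cst 1 - @erf R) -
    (((1 - g) / Num.sqrt pi) \*: (fun x => expR (- x ^+ 2) / x)) by [].
apply: is_derive_eq; rewrite /GRing.scale/=.
by field; rewrite !gt_eqF ?sqrt_pi_gt0.
Qed.

(* The defect increases up to sqrt ((1 - g) / (2 g)) and then decreases to 0,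
   so it has at most one zero. *)
Lemma mills_defect_inj0 g r1 r2 : 0 < g < 1 -> 0 < r1 -> 0 < r2 ->
  mills_defect g r1 = 0 -> mills_defect g r2 = 0 -> r1 = r2.
Proof.
move=> /andP[g0 g1].
wlog suff : r1 r2 / r1 < r2 -> 0 < r1 -> mills_defect g r1 = 0 ->
    mills_defect g r2 = 0 -> False.
  move=> H r10 r20 h1 h2; have [r12|r21|//] := ltgtP r1 r2.
    by case: (H _ _ r12).
  by case: (H _ _ r21).
move=> r12 r10 h1 h2.
pose dh r := expR (- r ^+ 2) / Num.sqrt pi * ((1 - g) / r ^+ 2 - 2 * g).
have c0 r : 0 < expR (- r ^+ 2) / Num.sqrt pi.
  by rewrite divr_gt0 ?expR_gt0 ?sqrt_pi_gt0.
have dhP (a b : R) : 0 < a -> forall x : R, a <= x <= b ->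
    is_derive x 1 (mills_defect g) (dh x).
  by move=> a0 x /andP[ax _]; apply: is_derive_mills_defect; exact: lt_le_trans ax.
(* Rolle between the two zeros gives a critical point c, where (1 - g) / c^2 = 2 g; beyond it the
   derivative is negative. *)
have [c /andP[r1c cr2]] := MVT_is_derive r12 (dhP _ _ r10).
rewrite h1 h2 subr0 => /esym/eqP.
rewrite mulf_eq0 [X in _ || X]gt_eqF ?subr_gt0// orbF.
rewrite mulf_eq0 gt_eqF//= subr_eq0 => /eqP cE.
have c_gt0 : 0 < c by exact: lt_trans r1c.
have dh_lt0 r : c < r -> dh r < 0.
  move=> cr; rewrite /dh pmulr_rlt0// subr_lt0 -cE ltr_pM2l ?subr_gt0//.
  have r_gt0 : 0 < r by exact: lt_trans cr.
  by rewrite ltf_pV2 ?posrE ?exprn_gt0// ltrXn2r// ltW.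
have decr (a b : R) : c < a -> a < b -> mills_defect g b < mills_defect g a.
  move=> ca ab; have a0 : 0 < a by exact: lt_trans ca.
  have [d /andP[ad _] E] := MVT_is_derive ab (dhP _ _ a0).
  by rewrite -subr_lt0 E pmulr_llt0 ?subr_gt0// dh_lt0// (lt_trans ca).
pose t := mills_defect g (r2 + 1).
have t0 : t < 0 by rewrite -h2 decr// ltrDl.
have r20 : 0 < r2 by exact: lt_trans r12.
pose k := (1 - g) / Num.sqrt pi.
have k0 : 0 < k by rewrite divr_gt0 ?sqrt_pi_gt0 ?subr_gt0.
(* Chosen so that k / r <= - t. With [erf r <= 1] the defect at r is then at least t, against its
   strict decrease past r2 + 1. This stands in for the limit 0 at infinity. *)
pose r := r2 + 1 + k / - t.
have r_gt : r2 + 1 < r by rewrite ltrDl divr_gt0// oppr_gt0.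
have r0 : 0 < r by rewrite (lt_trans _ r_gt)// addr_gt0.
have : mills_defect g r < t by rewrite decr// (lt_trans cr2)// ltrDl.
apply/negP; rewrite -leNgt /mills_defect -/k.
have erf1 : 0 <= 1 - erf r.
  have s0 : 0 < r * Num.sqrt 2 by rewrite mulr_gt0// sqrtr_gt0.
  have := gauss_tail_ge0 (r * Num.sqrt 2).
  rewrite gauss_tailE// mulfK ?gt_eqF ?sqrtr_gt0//.
  by rewrite pmulr_lge0 ?invr_gt0.
have kr : k * (expR (- r ^+ 2) / r) <= - t.
  rewrite mulrA ler_pdivrMr// (@le_trans _ _ k)//.
    by rewrite ler_piMr ?(ltW k0)// -expR0 ler_expR oppr_le0 sqr_ge0.
  rewrite /r mulrDr [- t * (k / _)]mulrC divfK ?oppr_eq0 ?lt_eqF//.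
  by rewrite lerDr mulr_ge0 ?oppr_ge0 ?ltW// addr_gt0.
lra.
Qed.

Lemma gauss_tail_mills g r : 0 < r ->
  gauss_tail (Num.sqrt 2 * r) -
    (1 - g) * (gauss_density (Num.sqrt 2 * r) / (Num.sqrt 2 * r)) =
  mills_defect g r / 2.
Proof.
move=> r0.
have sqrt2_gt0 : 0 < Num.sqrt 2 :> R by rewrite sqrtr_gt0.
rewrite gauss_tailE ?mulr_gt0// /mills_defect /gauss_density.
rewrite [_ / Num.sqrt 2]mulrC mulKf ?gt_eqF// exprMn sqr_sqrtr// -mulNr.
rewrite (_ : - (2 * r ^+ 2) / 2 = - r ^+ 2); last by lra.
have nz : (Num.sqrt pi != 0 :> R) * (Num.sqrt 2 != 0 :> R) * (r != 0).
  by rewrite !gt_eqF ?sqrt_pi_gt0.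
rewrite sqrtrM//.
have -> : 1 / (Num.sqrt 2 * Num.sqrt pi) * expR (- r ^+ 2) / (Num.sqrt 2 * r) =
    expR (- r ^+ 2) / (Num.sqrt 2 ^+ 2 * Num.sqrt pi * r).
  by field; rewrite !nz.
by rewrite sqr_sqrtr//; field; rewrite !nz.
Qed.

(** [xget] returns the exhibited solution once it is the only one; any other solution s is rescaled
    to s / sqrt 2 to apply [mills_defect_inj0]. *)
Lemma s_int_eq g r : 0 < g < 1 -> 0 < r -> mills_defect g r = 0 ->
  s_int g = Num.sqrt 2 * r.
Proof.
move=> g01 r0 hr; rewrite /s_int.
have sqrt2_gt0 : 0 < Num.sqrt 2 :> R by rewrite sqrtr_gt0.
apply: xget_unique => [|s [s0 sE]].
  split; first by rewrite mulr_gt0.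
  by apply/eqP; rewrite -subr_eq0 gauss_tail_mills// hr mul0r.
have sK : s = Num.sqrt 2 * (s / Num.sqrt 2) by rewrite mulrC divfK// gt_eqF.
rewrite sK; congr (_ * _); apply: (@mills_defect_inj0 g) => //.
  by rewrite divr_gt0.
have := gauss_tail_mills g (divr_gt0 s0 sqrt2_gt0).
by rewrite -sK sE subrr => /esym/eqP; rewrite mulf_eq0 invr_eq0 pnatr_eq0 orbF => /eqP.
Qed.

(** * External angle: the minimizer *)

Lemma is_derive_ext_fun alpha (y : R) : 0 < y ->
  is_derive y 1 (fun y : R => alpha * y ^+ 2 - (1 - alpha) * ln (erf y))
    (2 * alpha * y - (1 - alpha) * (2 / Num.sqrt pi * expR (- y ^+ 2) / erf y)).
Proof.
move=> y0.
have dl := @is_derive1_comp _ (@ln R) (@erf R) y _ _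
  (is_derive1_ln (erf_gt0 y0)) (is_derive_erf y0).
have -> : (fun y : R => alpha * y ^+ 2 - (1 - alpha) * ln (erf y)) =
  (alpha \*: (fun y : R => y ^+ 2)) - ((1 - alpha) \*: (@ln R \o @erf R)) by [].
apply: is_derive_eq; rewrite /GRing.scale/=.
by field; rewrite !gt_eqF ?sqrt_pi_gt0 ?erf_gt0.
Qed.

(* The minimized function is convex (both y ^+ 2 and - ln (erf y) are), so a
   critical point is its minimizer. *)
Lemma ext_fun_min alpha e : 0 < alpha < 1 -> 0 < e ->
    2 * alpha * e = (1 - alpha) * (2 / Num.sqrt pi * expR (- e ^+ 2) / erf e) ->
  forall y, 0 < y -> alpha * e ^+ 2 - (1 - alpha) * ln (erf e) <=
                     alpha * y ^+ 2 - (1 - alpha) * ln (erf y).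
Proof.
move=> /andP[a0 a1] e0 crit y y0.
pose k y : R := (1 - alpha) * (2 / Num.sqrt pi * expR (- y ^+ 2) / erf y).
pose df y := 2 * alpha * y - k y.
(* The factors exp(- y^2) and 1 / erf y are positive and decreasing, so [df] will be strictly
   increasing. *)
have k_decr (u v : R) : 0 < u -> u < v -> k v < k u.
  move=> u0 uv; have v0 : 0 < v by exact: lt_trans uv.
  rewrite /k ltr_pM2l ?subr_gt0// -!mulrA !ltr_pM2l ?invr_gt0 ?sqrt_pi_gt0//.
  apply: ltr_pM; rewrite ?expR_ge0 ?invr_ge0 ?erf_ge0 ?ltW//.
    by rewrite ltr_expR ltrN2 ltrXn2r// ltW.
  by rewrite ltf_pV2 ?posrE ?erf_gt0// erf_lt.
have df_incr (u v : R) : 0 < u -> u < v -> df u < df v.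
  by move=> u0 uv; rewrite /df ltrD ?ltrN2 ?k_decr// ltr_pM2l// mulr_gt0.
have dfe : df e = 0 by rewrite /df crit subrr.
have dP (a b : R) : 0 < a -> forall x : R, a <= x <= b -> is_derive x 1
    (fun y : R => alpha * y ^+ 2 - (1 - alpha) * ln (erf y)) (df x).
  by move=> ? x /andP[ax _]; apply: is_derive_ext_fun; exact: lt_le_trans ax.
have [ye|ey|->//] := ltgtP y e.
- have [c /andP[yc ce] E] := MVT_is_derive ye (dP _ _ y0).
  rewrite -subr_le0 E pmulr_lle0 ?subr_gt0// -dfe ltW// df_incr//.
  exact: lt_trans yc.
- have [c /andP[ec cy] E] := MVT_is_derive ey (dP _ _ e0).
  by rewrite -subr_ge0 E pmulr_lge0 ?subr_gt0// -dfe ltW// df_incr.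
Qed.

(** The minimum is attained at e, the point y = 0 having value +oo, and a minimum is unique by
    antisymmetry, so [xget] returns it. *)
Lemma Psi_ext_eq beta alpha e : 0 < alpha < 1 -> 0 < e ->
    2 * alpha * e = (1 - alpha) * (2 / Num.sqrt pi * expR (- e ^+ 2) / erf e) ->
  Psi_ext beta alpha = alpha * e ^+ 2 - (1 - alpha) * ln (erf e).
Proof.
move=> a01 e0 crit; rewrite /Psi_ext.
set m := _ - _.
have mval : ext_values alpha m%:E.
  by exists e; [rewrite /= ltW | rewrite /ext_fun gt_eqF].
have mlb : lbound (ext_values alpha) m%:E.
  move=> _ [y /= y0 <-]; rewrite /ext_fun; case: eqVneq => [_|yn0].
    by rewrite leey.
  by rewrite lee_fin ext_fun_min// lt0r yn0.
apply: xget_unique => // n [nval nlb].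
by apply/eqP; rewrite eq_le -!lee_fin nlb//= mlb.
Qed.

End exponents.

(** * The three exponents at the threshold *)

Theorem mainTheorem3 (R : realType) (beta alpha : R)
    (beta_gt0 : 0 < beta) (beta_lt_alpha : beta < alpha) (alpha_lt1 : alpha < 1)
    (threshold :
      (1 - beta) / alpha * Num.sqrt (2 / pi) *
        (expR (- (erfinv ((1 - alpha) / (1 - beta))) ^+ 2) /
         (Num.sqrt 2 * erfinv ((1 - alpha) / (1 - beta)))) = 1) :
  Psi_net beta alpha = 0.
Proof.
have alpha_gt0 : 0 < alpha by exact: lt_trans beta_lt_alpha.
have beta_lt1 : 0 < 1 - beta by rewrite subr_gt0 (lt_trans beta_lt_alpha).
have ab_gt0 : 0 < alpha - beta by rewrite subr_gt0.
have alpha1_gt0 : 0 < 1 - alpha by rewrite subr_gt0.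
have sqrt2_gt0 : 0 < Num.sqrt 2 :> R by rewrite sqrtr_gt0.
set p := (1 - alpha) / (1 - beta) in threshold.
set e := erfinv p in threshold.
have p_gt0 : 0 < p by rewrite divr_gt0.
(* If erf missed the value p, erfinv p and the threshold quotient would be 0. *)
have e_neq0 : e != 0.
  apply/eqP => e0; move: threshold; rewrite e0 mulr0 invr0 !mulr0 => /esym/eqP.
  by rewrite oner_eq0.
have erf_e : erf e = p.
  move: e_neq0; rewrite /e /erfinv; case: xgetP => [y _ //|_].
  by rewrite eqxx.
have e_gt0 : 0 < e.
  rewrite ltNge; apply/negP => /erf_le0; rewrite erf_e.
  by apply/negP; rewrite -ltNge.
have nz : (alpha != 0) * (1 - beta != 0) * (alpha - beta != 0) *
    (1 - alpha != 0) * (beta != 0) * (Num.sqrt pi != 0 :> R) * (e != 0).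
  by rewrite !gt_eqF ?sqrt_pi_gt0.
have gaussE : expR (- e ^+ 2) = alpha * Num.sqrt pi * e / (1 - beta).
  move: threshold; rewrite sqrtrM// sqrtrV ?pi_ge0// => th.
  (* The exponential is multiplied by 1 / 1 and the denominator replaced by the left side of the
     threshold, so that the exponential cancels. *)
  rewrite -[LHS]mulr1 -[in LHS](divff (oner_neq0 R)) -[X in _ / X]th.
  field; rewrite !nz !gt_eqF// ?expR_gt0//.
have g01 : 0 < beta / alpha < 1.
  by rewrite divr_gt0//= ltr_pdivrMr// mul1r.
(* Both 1 - p and the term subtracted from it equal (alpha - beta) / (1 - beta). *)
have s_e : s_int (beta / alpha) = Num.sqrt 2 * e.
  apply: s_int_eq => //; rewrite /mills_defect erf_e gaussE /p.
  by field; rewrite !nz.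
have ext_e : Psi_ext beta alpha = alpha * e ^+ 2 - (1 - alpha) * ln p.
  rewrite (@Psi_ext_eq _ _ _ e) ?erf_e ?alpha_gt0//.
  (* The critical point equation reduces to (1 - beta) p = 1 - alpha. *)
  by rewrite gaussE /p; field; rewrite !nz.
pose q := (alpha - beta) / (1 - beta).
have q_gt0 : 0 < q by rewrite divr_gt0.
have com_e : Psi_com beta alpha =
    (alpha - beta) * ln 2 - (alpha - beta) * ln q - (1 - alpha) * ln p.
  rewrite /Psi_com /entropy -/q (_ : 1 - q = p); last first.
    by rewrite /q /p; field; rewrite !nz.
  by rewrite /q /p; field; rewrite !nz.
have xi_e : xi_int (beta / alpha) (y_int (beta / alpha)) =
    - (alpha / (alpha - beta)) * e ^+ 2 - ln q.
  have E1 : - (1 / 2) * y_int (beta / alpha) ^+ 2 *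
      ((1 - beta / alpha) / (beta / alpha)) = - (beta / (alpha - beta)) * e ^+ 2.
    rewrite /y_int s_e !exprMn sqr_sqrtr//.
    by field; rewrite !nz.
  (* The exponential is reintroduced so that the logarithm splits: log(2 / pi) / 2 cancels in
     [xi_int], and - e^2 adds to [E1]. *)
  have E2 : y_int (beta / alpha) / (beta / alpha) =
      Num.sqrt (2 / pi) * (expR (- e ^+ 2) / q).
    rewrite /y_int s_e gaussE /q sqrtrM// sqrtrV ?pi_ge0//.
    by field; rewrite !nz.
  have twopi : 0 < 2 / pi :> R by rewrite divr_gt0 ?pi_gt0.
  have lnsqrt : ln (Num.sqrt (2 / pi)) = ln (2 / pi) / 2 :> R.
    rewrite -[in RHS](sqr_sqrtr (ltW twopi)) lnXn ?sqrtr_gt0//.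
    by field.
  rewrite /xi_int E1 E2 [ln (Num.sqrt _ * _)]lnM ?posrE ?sqrtr_gt0// ?divr_gt0 ?expR_gt0//.
  rewrite [ln (expR _ / _)]ln_div ?posrE ?expR_gt0// expRK lnsqrt.
  by field; rewrite !nz.
rewrite /Psi_net /Psi_int com_e ext_e xi_e.
by field; rewrite !nz.
Qed.
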